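(* For every $\varepsilon\in(0,1]$ there exists an $n(\varepsilon)\in\mathbb{N}$ such that for every $n\geq n(\varepsilon)$ and every centrally symmetric convex body $K\subset\mathbb{R}^n$ with $\dim(K\cap\mathbb{Z}^n)=n$, we have \[\operatorname{vol}(K)\geq\frac{(2-\varepsilon)^n}{n!}\,\mathrm{G}(K).\] The constant $2$ cannot be replaced by a bigger one; that is, for no real number $c>2$ does the preceding statement remain true when $(2-\varepsilon)^n$ is replaced by $(c-\varepsilon)^n$.
   Context: A convex body in $\mathbb{R}^n$ is a compact convex set with nonempty interior. It is centrally symmetric if $K=-K$. $\operatorname{vol}$ is the Lebesgue measure on $\mathbb{R}^n$. For a bounded set $S\subset\mathbb{R}^n$, $\mathrm{G}(S)=\#(S\cap\mathbb{Z}^n)$ is the number of integer lattice points in $S$. For $A\subseteq\mathbb{R}^n$, $\dim A$ denotes the dimension of the affine hull of $A$. *)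

(* Defs.v *)
From HB Require Import structures.
From mathcomp Require Import all_boot all_order all_algebra finmap.
From mathcomp Require Import all_classical all_reals all_analysis.

Set Implicit Arguments.
Unset Strict Implicit.
Unset Printing Implicit Defensive.
Import Order.TTheory GRing.Theory Num.Theory.
Import numFieldNormedType.Exports.
Local Open Scope classical_set_scope.
Local Open Scope ring_scope.

Section LebesgueTuple.
Context {R : realType}.

Definition cons_pair n (p : measurableTypeR R * n.-tuple (measurableTypeR R)) :
  n.+1.-tuple (measurableTypeR R) := [tuple of p.1 :: p.2].

(* Lebesgue measure on R^n as the n-fold product of Lebesgue measure on R. *)
Fixpoint lebesgue_tuple n : set (n.-tuple (measurableTypeR R)) -> \bar R :=
  if n is m.+1 then
    pushforward (lebesgue_measure \x @lebesgue_tuple m)%E (@cons_pair m)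
  else \d_ [tuple].

Lemma measurable_cons_pair n : measurable_fun [set: _] (@cons_pair n).
Proof. exact: measurable_cons. Qed.

Lemma measurable_uncons n :
  measurable_fun [set: n.+1.-tuple (measurableTypeR R)]
    (fun t => (thead t, [tuple of behead t] : n.-tuple (measurableTypeR R))).
Proof.
by apply: measurable_fun_pair; [exact: measurable_tnth|exact: measurable_behead].
Qed.

Lemma pushforward_cons_pair_sigma_finite n
    (mu : {measure
             set (measurableTypeR R * n.-tuple (measurableTypeR R))%type -> \bar R}) :
  sigma_finite setT mu -> sigma_finite setT (pushforward mu (@cons_pair n)).
Proof.
move=> [F TF mF].
exists (fun k => (fun t : n.+1.-tuple _ => (thead t, [tuple of behead t])) @^-1` F k).
  by rewrite -preimage_bigcup -TF preimage_setT.
move=> k; have [mFk Fkoo] := mF k; split.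
  by rewrite -[X in measurable X]setTI; exact: measurable_uncons.
rewrite /pushforward -comp_preimage (_ : _ \o _ = id)//.
by apply/funext => -[x t]/=; congr pair; apply: val_inj.
Qed.

(* The library's SigmaFiniteMeasure instance for \x is found only when both
   factors are subprobabilities, so its proof is repeated here. *)
Lemma product_measure_sigma_finite d1 d2 (T1 : measurableType d1)
    (T2 : measurableType d2) (m1 : {sigma_finite_measure set T1 -> \bar R})
    (m2 : {sigma_finite_measure set T2 -> \bar R}) :
  sigma_finite setT (m1 \x m2)%E.
Proof.
have /sigma_finiteP[F [TF ndF Foo]] := sigma_finiteT m1.
have /sigma_finiteP[G [TG ndG Goo]] := sigma_finiteT m2.
exists (fun n => F n `*` G n).
  rewrite -setXTT TF TG predeqE => -[x y]; split.
    move=> [/= [n _ Fnx] [k _ Gky]]; exists (maxn n k) => //; split.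
    - by move: x Fnx; exact/subsetPset/ndF/leq_maxl.
    - by move: y Gky; exact/subsetPset/ndG/leq_maxr.
  by move=> [n _ []/= ? ?]; split; exists n.
move=> k; have [? ?] := Foo k; have [? ?] := Goo k.
split; first exact: measurableX.
by rewrite product_measure1E// lte_mul_pinfty// ge0_fin_numE.
Qed.

Let lebesgue_tuple_spec n :
  {mu : {sigma_finite_measure set (n.-tuple (measurableTypeR R)) -> \bar R} |
    mu = @lebesgue_tuple n :> (set _ -> \bar R)}.
Proof.
elim: n => [|n [mu muE]]; first by exists \d_ [tuple].
pose nu : {measure set (n.+1.-tuple (measurableTypeR R)) -> \bar R} :=
  measure_function_pushforward__canonical__measure_function_Measure
    (lebesgue_measure \x mu)%E (@measurable_cons_pair n).
pose nu_sigma_finite := Measure_isSigmaFinite.Build _ _ R nu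
  (pushforward_cons_pair_sigma_finite
     (product_measure_sigma_finite lebesgue_measure mu)).
exists (HB.pack_for {sigma_finite_measure
  set (n.+1.-tuple (measurableTypeR R)) -> \bar R}
  (Measure.sort nu) nu_sigma_finite).
by rewrite /= -muE.
Qed.

Lemma lebesgue_tuple0 n : @lebesgue_tuple n set0 = 0.
Proof. by have [mu <-] := lebesgue_tuple_spec n; exact: measure0. Qed.

Lemma lebesgue_tuple_ge0 n A : (0 <= @lebesgue_tuple n A)%E.
Proof. by have [mu <-] := lebesgue_tuple_spec n; exact: measure_ge0. Qed.

Lemma lebesgue_tuple_sigma_additive n : semi_sigma_additive (@lebesgue_tuple n).
Proof.
by have [mu <-] := lebesgue_tuple_spec n; exact: measure_semi_sigma_additive.
Qed.

HB.instance Definition _ n := isMeasure.Build _ _ _ (@lebesgue_tuple n)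
  (lebesgue_tuple0 n) (@lebesgue_tuple_ge0 n) (@lebesgue_tuple_sigma_additive n).

Lemma lebesgue_tuple_sigma_finite n : sigma_finite setT (@lebesgue_tuple n).
Proof. by have [mu <-] := lebesgue_tuple_spec n; exact: sigma_finiteT. Qed.

HB.instance Definition _ n := Measure_isSigmaFinite.Build _ _ _
  (@lebesgue_tuple n) (@lebesgue_tuple_sigma_finite n).

Lemma lebesgue_tuple_box n (A : 'I_n -> set (measurableTypeR R)) :
  (forall i, measurable (A i)) ->
  lebesgue_tuple [set t | forall i, A i (tnth t i)] =
  (\prod_(i < n) lebesgue_measure (A i))%E.
Proof.
elim: n => [|n ih] in A *; move=> mA.
  by rewrite big_ord0 /= diracE mem_set// => -[].
rewrite big_ord_recl -ih//= /pushforward -product_measure1E//; last first.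
  rewrite (_ : [set _ | _] = \bigcap_(i in [set: 'I_n])
      ((fun t => tnth t i) @^-1` A (lift ord0 i))).
    apply: fin_bigcap_measurable => // i _.
    by rewrite -[X in measurable X]setTI; apply: measurable_tnth.
  by apply/seteqP; split=> t /= h i => [_|]; exact: h.
congr (_ _); apply/seteqP; split=> -[x t]/= => [h|[h0 h] i].
  by split=> [|i]; [exact: (h ord0)|move: (h (lift ord0 i)); rewrite tnthS].
by case: (unliftP ord0 i) => [j ->|->//]; rewrite tnthS.
Qed.

End LebesgueTuple.

Section Definitions.
Context {R : realType}.

(* Compact sets of row vectors correspond to measurable sets of tuples. *)
Definition vol n (A : set 'rV[R]_n) : \bar R :=
  lebesgue_tuple [set t : n.-tuple R | A (\row_i tnth t i)].

Definition convex_body n (K : set 'rV[R]_n) : Prop :=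
  [/\ compact K, convex_set K & K° !=set0].

Definition centrally_symmetric n (K : set 'rV[R]_n) : Prop :=
  K = [set - x | x in K].

Definition integer_lattice n : set 'rV[R]_n :=
  [set x | forall i, x 0 i \is a Num.int].
Arguments integer_lattice n : clear implicits.

(* fset_set is meaningful on finite sets only, which covers every bounded S. *)
Definition lattice_count n (S : set 'rV[R]_n) : nat :=
  #|` fset_set (S `&` integer_lattice n)|.

Definition affine_hull n (A : set 'rV[R]_n) : set 'rV[R]_n :=
  [set x | exists m (c : 'I_m -> R) (a : 'I_m -> 'rV[R]_n),
    [/\ forall i, A (a i), \sum_i c i = 1 & x = \sum_i c i *: a i]].

(* dim A = d: the affine hull of A is a translate of a d-dimensional linear
   subspace. It holds for no d when A is empty. *)
Definition affine_dim n (A : set 'rV[R]_n) (d : nat) : Prop :=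
  exists (p : 'rV[R]_n) (U : {vspace 'rV[R]_n}),
    affine_hull A = [set p + u | u in [set` U]] /\ \dim U = d.

End Definitions.

Arguments integer_lattice R n : clear implicits.

(* Main.v *)
Require Import Defs.
From HB Require Import structures.
From mathcomp Require Import all_boot all_order all_algebra finmap.
From mathcomp Require Import all_classical all_reals all_analysis.
From mathcomp Require Import perm measurable_realfun zify ring lra.

Import Order.TTheory GRing.Theory Num.Theory.
Import numFieldNormedType.Exports.
Local Open Scope classical_set_scope.
Local Open Scope ring_scope.

(** A cross-polytope [C] spanned by lattice points of [K] is packed, with
controlled overlap, into [K]. Since [K] is symmetric, convex and contains [n]
linearly independent integer vectors, the rows of a matrix [A], it contains
[C = {y A : |y|_1 <= 1}], whose volume is [|det A| 2^n / n!]
([vol_cross_polytope], [vol_cross_polytope_affine]).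

Fix an integer [t > 0]. For every integer point [x] of [K] the convex
combination [(x + t C) / (t + 1)] lies in [K] ([lattice_piece_sub]), and it
has volume [|det A| (2 t / (t + 1))^n / n!]. These [G(K)] sets may overlap, but
a point [p] lies in few of them. If two integer points [x], [y] have [p] in
their sets, and if [x - y = w A] with an integer vector [w], then
[|w|_1 <= 2 t]. There are [|det A|] classes of [Z^n] modulo [Z^n A], and at
most [(2 n + 1)^(2 t)] integer vectors [w] with [|w|_1 <= 2 t]: each is the end
of a walk of [2 t] steps, a step being null or plus or minus a basis vector.
Hence [p] lies in at most [|det A| (2 n + 1)^(2 t)] of the sets
([count_lattice_translates]). The factor [|det A|] cancels, and
[lattice_count_le_vol] reads
[G(K) (2 t / (t + 1))^n / n! <= (2 n + 1)^(2 t) vol K].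
With [t] chosen so that [2 t / (t + 1) > 2 - eps], the exponential gain
[((2 t / (t + 1)) / (2 - eps))^n] eventually beats the polynomial
[(2 n + 1)^(2 t)] ([pow_dominates_polynomial]).

The constant is optimal because the standard cross-polytope has volume
[2^n / n!] and contains more than one lattice point, so that
[(c - eps)^n G(K) <= 2^n] fails as soon as [c - eps >= 2].

Two points concern the measure. The volume is an iterated product of
one-dimensional measures, so linear maps are handled by Fubini: block
triangular matrices change one coordinate at a time, and an LU decomposition
reduces any invertible matrix to these up to a permutation of the columns,
which the l1 norm does not see ([scales_vol_mul_perm]). Moreover, iterated
integrals are monotone on all sets ([le_vol]), which compares the union of the
small cross-polytopes with an arbitrary convex body. *)

(** * Integration on a measurable space and on the line *)

(** It is enough to know the effect of the change of variables on the measures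
of sets: the pushforward of [m] by [phi] is then the scaled measure [k m]. *)
Lemma ge0_integral_scaling d (X : measurableType d) (R : realType)
    (m : {measure set X -> \bar R}) (phi : X -> X) (k : R) (g : X -> \bar R) :
  0 <= k -> measurable_fun [set: X] phi ->
  (forall A, measurable A -> m (phi @^-1` A) = (k%:E * m A)%E) ->
  measurable_fun [set: X] g -> (forall x, 0 <= g x)%E ->
  (\int[m]_x g (phi x) = k%:E * \int[m]_x g x)%E.
Proof.
move=> k0 mphi mE mg g0.
rewrite -[LHS]/(\int[m]_(x in setT) (g \o phi) x)%E -(preimage_setT phi).
rewrite -ge0_integral_pushforward//.
rewrite -[k in RHS]/((NngNum k0)%:num) -(ge0_integral_mscale _ measurableT)//.
by apply: eq_measure_integral => A mA _; exact: mE.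

Qed.

(** The integral of a nonnegative function is a supremum over the simple
functions below it, hence monotone on all nonnegative functions. *)
Lemma ge0_le_integral_all d (X : measurableType d) (R : realType)
    (m : {measure set X -> \bar R}) (f g : X -> \bar R) :
  (forall x, 0 <= f x)%E -> (forall x, f x <= g x)%E ->
  (\int[m]_x f x <= \int[m]_x g x)%E.
Proof.
move=> f0 fg.
have g0 x : (0 <= g x)%E := le_trans (f0 x) (fg x).
rewrite !ge0_integralTE//; apply: ereal_sup_le => _ [h /= hf <-].
by exists h => //= x; exact: le_trans (hf x) (fg x).
Qed.

(** Double counting: the sum of the indicators of the [P i] is bounded by [N]
times the indicator of their union, and integration gives the inequality. *)
Lemma sum_measure_le_multiplicity d (X : measurableType d) (R : realType)
    (m : {measure set X -> \bar R}) (I : choiceType) (F : seq I)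
    (P : I -> set X) (N : nat) :
  (forall i, measurable (P i)) ->
  (forall p, (count (fun i => p \in P i) F <= N)%N) ->
  (\sum_(i <- F) m (P i) <= N%:R%:E * m (\big[setU/set0]_(i <- F) P i))%E.
Proof.
move=> mP PN; set U := \big[setU/set0]_(i <- F) _.
have mU : measurable U by apply: bigsetU_measurable.
rewrite (eq_bigr (fun i => \int[m]_x (\1_(P i) x)%:E)%E); last first.
  by move=> i _; rewrite integral_indic// setIT.
rewrite -ge0_integral_sum//; last first.
  by move=> i; apply/measurable_EFinP.
have mI : measurable_fun setT (fun x => (\1_U x)%:E : \bar R).
  exact/measurable_EFinP.
rewrite -[U in leRHS]setIT -integral_indic//.
rewrite -(ge0_integralZl m measurableT mI)//.
apply: ge0_le_integral_all => x.
  by apply: sume_ge0 => i _; rewrite lee_fin.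
rewrite sumEFin lee_fin; under eq_bigr do rewrite indicE.
have countE : (\sum_(i <- F) (x \in P i))%N = count (fun i => x \in P i) F.
  by rewrite -sum1_count [RHS]big_mkcond.
rewrite -natr_sum countE.
have [xU|xU] := pselect (U x).
  by rewrite indicE mem_set// mulr1 ler_nat.
rewrite (_ : count _ _ = 0%N) ?mulr_ge0//; apply/eqP.
rewrite -leqn0 leqNgt -has_count; apply/negP => /hasP[i iF /set_mem Pix].
by apply: xU; rewrite /U -bigcup_seq; exists i.
Qed.

(** By uniqueness of the Lebesgue measure, only intervals have to be checked;
their preimages are intervals, reversed when [a] is negative. *)
Lemma lebesgue_measure_affine (R : realType) (a b : R) (A : set R) :
  a != 0 -> measurable (A : set (measurableTypeR R)) ->
  lebesgue_measure [set x : R | A (x * a + b)] =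
    ((`|a|^-1)%:E * lebesgue_measure A)%E.
Proof.
move=> a0 mA.
pose phi (x : measurableTypeR R) : measurableTypeR R := x * a + b.
have mphi : measurable_fun setT phi.
  by apply: measurable_funD => //; apply: measurable_funM.
pose mu : {measure set (measurableTypeR R) -> \bar R} :=
  mscale (NngNum (normr_ge0 a))
   (measure_function_pushforward__canonical__measure_function_Measure
     lebesgue_measure mphi).
have -> : [set x : R | A (x * a + b)] = phi @^-1` A by [].
suff -> : lebesgue_measure A = mu A.
  by rewrite /mu /mscale/= muleA -EFinM mulVf ?normr_eq0// mul1e.
apply: lebesgue_measure_unique => // _ [[u v]] _ <-.
rewrite /mu/= /mscale/= /pushforward.
case: (ltrgt0P a) a0 => // [a_gt0|a_lt0] _.
- have -> : phi @^-1` `]u, v]%classic = `](u - b) / a, (v - b) / a]%classic.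
    apply/seteqP; split=> x /=; rewrite !in_itv/= /phi;
    by rewrite ltr_pdivrMr// ler_pdivlMr// ltrBlDr lerBrDr.
  rewrite !lebesgue_measure_itv/= !lte_fin ltr_pM2r ?invr_gt0// ltrD2r.
  case: ifPn => _; last by rewrite mule0.
  by rewrite -!EFinD -EFinM; congr EFin; field; rewrite gt_eqF.
- have -> : phi @^-1` `]u, v]%classic = `[(v - b) / a, (u - b) / a[%classic.
    apply/seteqP; split=> x /=; rewrite !in_itv/= /phi;
    by rewrite ltr_ndivlMr// ler_ndivrMr// ltrBlDr lerBrDr andbC.
  rewrite !lebesgue_measure_itv/= !lte_fin ltr_nM2r ?invr_lt0// ltrD2r.
  case: ifPn => _; last by rewrite mule0.
  by rewrite -!EFinD -EFinM; congr EFin; field; rewrite lt_eqF.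
Qed.

Lemma ge0_even_integral (R : realType) (f : R -> \bar R) :
  measurable_fun setT (f : measurableTypeR R -> \bar R) ->
  (forall x, 0 <= f x)%E -> (forall x, f (- x) = f x) ->
  (\int[lebesgue_measure]_x f x =
    2%:E * \int[lebesgue_measure]_(x in `[0%R, +oo[) f x)%E.
Proof.
move=> mf f0 fN.
rewrite mule_natl mule2n {2}ge0_integration_by_substitution0//.
under [X in (_ + X)%E]eq_integral do rewrite fN.
rewrite -integral_itv_bndo_bndc; last exact: measurable_funTS.
rewrite -ge0_integral_setU//=.
- by rewrite setUC -setCitvr setvU.
- exact: measurable_funTS.
- by rewrite -setCitvr; exact/disj_setPCl.
Qed.

(** The regularity assumptions of the fundamental theorem of calculus hold for
polynomials, which covers the only primitive computed below. *)
Lemma integral_deriv_poly (R : realType) (p : {poly R}) (a b : R) : a < b ->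
  (\int[lebesgue_measure]_(x in `[a, b]) (p^`().[x])%:E =
    (p.[b])%:E - (p.[a])%:E)%E.
Proof.
move=> ab.
have cont (q : {poly R}) x : {for x, continuous (horner q)}.
  apply: differentiable_continuous; apply/derivable1_diffP.
  exact: (@ex_derive _ _ _ _ _ _ _ (is_derive_poly q x)).
apply: continuous_FTC2 => //.
- by apply: continuous_subspaceT => x; exact: cont.
- split=> [x _||].
  + exact: (@ex_derive _ _ _ _ _ _ _ (is_derive_poly p x)).
  + by apply: cvg_at_right_filter; exact: cont.
  + by apply: cvg_at_left_filter; exact: cont.
- move=> x _; rewrite derive1E.
  exact: (@derive_val _ _ _ _ _ _ _ (is_derive_poly p x)).
Qed.

(** * Row vectors, tuples and Fubini *)

(** The measurable structure is carried by tuples and the linear algebra by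
row vectors; [row_of_tuple] and [tuple_of_row] go back and forth. *)
Definition row_of_tuple (R : realType) n (t : n.-tuple R) : 'rV[R]_n :=
  \row_i tnth t i.
Arguments row_of_tuple {R n}.

Definition tuple_of_row (R : realType) n (x : 'rV[R]_n) : n.-tuple R :=
  [tuple x 0 i | i < n].
Arguments tuple_of_row {R n}.

Lemma tuple_of_rowK (R : realType) n :
  cancel (@tuple_of_row R n) row_of_tuple.
Proof. by move=> x; apply/rowP => i; rewrite mxE tnth_mktuple. Qed.

Lemma row_of_tupleK (R : realType) n :
  cancel (@row_of_tuple R n) tuple_of_row.
Proof. by move=> t; apply/eq_from_tnth => i; rewrite tnth_mktuple mxE. Qed.

Lemma row_of_tuple_cons (R : realType) n (x : R) (t : n.-tuple R) :
  row_of_tuple [tuple of x :: t] = row_mx x%:M (row_of_tuple t)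
    :> 'rV_(1 + n).
Proof.
apply/rowP=> i; rewrite mxE; case: (split_ordP i) => j ->.
  by rewrite row_mxEl ord1 mxE eqxx mulr1n (tnth_nth 0).
by rewrite row_mxEr mxE !(tnth_nth 0).
Qed.

Definition measurable_row (R : realType) n (A : set 'rV[R]_n) : Prop :=
  measurable
    ((@row_of_tuple R n : n.-tuple (measurableTypeR R) -> _) @^-1` A).
Arguments measurable_row {R n}.

Lemma volE (R : realType) n (A : set 'rV[R]_n) :
  vol A = lebesgue_tuple (row_of_tuple @^-1` A).
Proof. by []. Qed.

Lemma vol_cons (R : realType) n (A : set 'rV[R]_n.+1) :
  (vol A = \int[lebesgue_measure]_x
    vol [set y : 'rV[R]_n | A (row_mx x%:M y : 'rV_(1 + n))])%E.
Proof.
rewrite !volE /= /pushforward /product_measure1; apply: eq_integral => x _ /=.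
rewrite volE; congr lebesgue_tuple; apply/seteqP; split=> t /=;
by rewrite /xsection/= inE /cons_pair/= -row_of_tuple_cons.
Qed.

Lemma vol_ge0 (R : realType) n (A : set 'rV[R]_n) : (0 <= vol A)%E.
Proof. exact: measure_ge0. Qed.

(** The volume is an iterated integral of nonnegative functions, so the
inequality holds for non-measurable sets as well. It will compare unions of
cross-polytopes with an arbitrary convex body. *)
Lemma le_vol (R : realType) n (A B : set 'rV[R]_n) :
  A `<=` B -> (vol A <= vol B)%E.
Proof.
elim: n A B => [|n ih] A B AB.
  rewrite !volE /= !diracE lee_fin ler_nat.
  case: (boolP (_ \in row_of_tuple @^-1` A)) => // /set_mem/AB memB.
  by rewrite mem_set.
rewrite !vol_cons; apply: ge0_le_integral_all => x; first exact: vol_ge0.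
by apply: ih => y; exact: AB.
Qed.

Lemma measurable_fun_affine (R : realType) m n (M : 'M[R]_(m, n))
    (b : 'rV[R]_n) :
  measurable_fun setT (fun t : m.-tuple (measurableTypeR R) =>
    tuple_of_row (row_of_tuple t *m M + b) : n.-tuple (measurableTypeR R)).
Proof.
apply/measurable_fun_tnthP => i.
rewrite (_ : _ \o _ = fun t => (\sum_(j < m) tnth t j * M j i) + b 0 i).
  apply: measurable_funD => //; apply: measurable_sum => j.
  by apply: measurable_funM => //; exact: measurable_tnth.
apply/funext => t /=; rewrite tnth_mktuple !mxE; congr (_ + _).
by apply: eq_bigr => j _; rewrite mxE.
Qed.

Lemma measurable_row_affine (R : realType) m n (M : 'M[R]_(m, n))
    (b : 'rV[R]_n) (A : set 'rV[R]_n) :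
  measurable_row A -> measurable_row [set x | A (x *m M + b)].
Proof.
move=> mA.
rewrite /measurable_row -[X in measurable X]setTI.
have -> : row_of_tuple @^-1` [set x | A (x *m M + b)] =
    (fun t => tuple_of_row (row_of_tuple t *m M + b)) @^-1`
      (row_of_tuple @^-1` A).
  by apply/seteqP; split=> t /=; rewrite tuple_of_rowK.
exact: (measurable_fun_affine _ _ _ M b).
Qed.

Lemma measurable_section (R : realType) n (A : set 'rV[R]_n.+1) (x : R) :
  measurable_row A ->
  measurable_row [set y : 'rV[R]_n | A (row_mx x%:M y : 'rV_(1 + n))].
Proof.
move=> /(measurable_row_affine R n n.+1 (row_mx 0 1%:M : 'M[R]_(n, 1 + n))
  (row_mx x%:M 0 : 'rV_(1 + n))).
have E (y : 'rV[R]_n) : y *m (row_mx 0 1%:M : 'M[R]_(n, 1 + n)) +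
    (row_mx x%:M 0 : 'rV_(1 + n)) = row_mx x%:M y.
  by rewrite mul_mx_row mulmx1 mulmx0 add_row_mx addr0 add0r.
by congr measurable_row; apply/seteqP; split=> y /=; rewrite E.
Qed.

Lemma measurable_cons_preimage (R : realType) n (A : set 'rV[R]_n.+1) :
  measurable_row A ->
  measurable (@cons_pair R n @^-1` (row_of_tuple @^-1` A)).
Proof.
move=> mA; rewrite -[X in measurable X]setTI.
refine (@measurable_cons_pair R n measurableT _ mA).
Qed.

Lemma measurable_fun_vol_section (R : realType) n (A : set 'rV[R]_n.+1) :
  measurable_row A ->
  measurable_fun (setT : set (measurableTypeR R)) (fun x : measurableTypeR R =>
    vol [set y : 'rV[R]_n | A (row_mx x%:M y : 'rV_(1 + n))]).
Proof.
move=> /measurable_cons_preimage mA.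
apply: eq_measurable_fun
  (measurable_fun_xsection (@lebesgue_tuple R n) mA) => x _ /=.
rewrite volE; congr lebesgue_tuple; apply/seteqP; split=> t /=;
by rewrite /xsection/= inE /cons_pair/= -row_of_tuple_cons.
Qed.

Lemma ysection_cons (R : realType) n (A : set 'rV[R]_n.+1) t :
  ysection (@cons_pair R n @^-1` (row_of_tuple @^-1` A)) t =
  [set x : R | A (row_mx x%:M (row_of_tuple t) : 'rV_(1 + n))].
Proof.
apply/seteqP; split=> x /=;
by rewrite /ysection/= inE /cons_pair/= -row_of_tuple_cons.
Qed.

(** Integrating the other coordinates last is what block lower triangular
matrices require: they translate the first coordinate by an amount that
depends on the other ones. *)
Lemma vol_cons_swap (R : realType) n (A : set 'rV[R]_n.+1) :
  measurable_row A ->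
  (vol A = \int[@lebesgue_tuple R n]_t lebesgue_measure
    [set x : R | A (row_mx x%:M (row_of_tuple t) : 'rV_(1 + n))])%E.
Proof.
move=> /measurable_cons_preimage mA.
have := indic_fubini_tonelli lebesgue_measure (@lebesgue_tuple R n) mA.
rewrite indic_fubini_tonelli_FE// indic_fubini_tonelli_GE// => E.
rewrite volE /= /pushforward /product_measure1 [LHS]E.
by apply: eq_integral => t _ /=; rewrite ysection_cons.
Qed.

Lemma measurable_first_section (R : realType) n (A : set 'rV[R]_n.+1)
    (y : 'rV[R]_n) :
  measurable_row A ->
  measurable ([set x | A (row_mx x%:M y : 'rV_(1 + n))] :
    set (measurableTypeR R)).
Proof.
move=> /measurable_cons_preimage mA.
have := measurable_ysection (tuple_of_row y) mA.
by rewrite ysection_cons tuple_of_rowK.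
Qed.

Lemma measurable_fun_first_section (R : realType) n (A : set 'rV[R]_n.+1) :
  measurable_row A ->
  measurable_fun setT (fun t : n.-tuple (measurableTypeR R) =>
    lebesgue_measure
      [set x : R | A (row_mx x%:M (row_of_tuple t) : 'rV_(1 + n))]).
Proof.
move=> /measurable_cons_preimage mA.
apply: eq_measurable_fun
  (measurable_fun_ysection lebesgue_measure mA) => t _ /=.
by rewrite ysection_cons.
Qed.

(** * Volume and linear maps *)

(** The substitution rule is stated for all translates at once, because Fubini
turns the off-diagonal blocks of a triangular matrix into translations that
depend on the coordinates already fixed. *)
Definition scales_vol (R : realType) n (M : 'M[R]_n) : Prop :=
  forall (A : set 'rV[R]_n) (b : 'rV[R]_n), measurable_row A ->
  vol [set x | A (x *m M + b)] = ((`|\det M|^-1)%:E * vol A)%E.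
Arguments scales_vol {R n}.

Lemma scales_vol_mul (R : realType) n (M N : 'M[R]_n) :
  scales_vol M -> scales_vol N -> scales_vol (M *m N).
Proof.
move=> sM sN A b mA.
have -> : [set x | A (x *m (M *m N) + b)] =
    [set x | [set y | A (y *m N + b)] (x *m M + 0)].
  by apply/seteqP; split=> x /=; rewrite addr0 mulmxA.
rewrite sM; last exact: measurable_row_affine.
by rewrite sN// muleA -EFinM det_mulmx normrM invfM.
Qed.

(** For a fixed first coordinate [x], the remaining coordinates undergo the map
of matrix [M] followed by a translation by [x u]; what is left is an affine
substitution in [x]. *)
Lemma scales_vol_ublock (R : realType) n (a : R) (u : 'rV[R]_n) (M : 'M[R]_n) :
  a != 0 -> scales_vol M -> scales_vol (block_mx a%:M u 0 M : 'M[R]_(1 + n)).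
Proof.
move=> a0 sM A b mA.
have [c [v bE]] : exists c v, b = row_mx c%:M v :> 'rV_(1 + n).
  exists (lsubmx (b : 'rV_(1 + n)) 0 0), (rsubmx (b : 'rV_(1 + n))).
  rewrite -[LHS](hsubmxK (b : 'rV_(1 + n))); congr row_mx.
  exact: mx11_scalar.
have mg := measurable_fun_vol_section _ _ _ mA.
set g := (X in measurable_fun _ X) in mg.
have affE (x : R) y : (row_mx x%:M y : 'rV_(1 + n)) *m block_mx a%:M u 0 M + b =
    row_mx (x * a + c)%:M (y *m M + (x *: u + v)) :> 'rV_(1 + n).
  rewrite bE mul_row_block add_row_mx mulmx0 addr0 -scalar_mxM mul_scalar_mx.
  by rewrite -raddfD/= [x *: u + y *m M]addrC addrA.
have gE x : vol [set y : 'rV[R]_n |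
      A ((row_mx x%:M y : 'rV_(1 + n)) *m block_mx a%:M u 0 M + b)] =
    ((`|\det M|^-1)%:E * g (x * a + c)%R)%E.
  rewrite -(sM _ (x *: u + v)); last exact: measurable_section.
  by congr vol; apply/seteqP; split=> y /=; rewrite affE.
rewrite (vol_cons _ n); under eq_integral do rewrite /= gE.
have maff : measurable_fun setT (fun x : measurableTypeR R => x * a + c).
  by apply: measurable_funD => //; apply: measurable_funM.
rewrite ge0_integralZl//=; last first.
  exact: (measurableT_comp mg maff).
rewrite (ge0_integral_scaling _ _ R lebesgue_measure
  (fun x => x * a + c) `|a|^-1 g)//.
- rewrite (vol_cons _ n) muleA -EFinM (det_ublock a%:M) det_scalar expr1.
  by rewrite normrM invfM mulrC.
- by move=> B mB; exact: lebesgue_measure_affine.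
Qed.

(** For fixed remaining coordinates, the first one is scaled by [a] and
translated; what is left is the affine substitution of matrix [M] in the
remaining coordinates. *)
Lemma scales_vol_lblock (R : realType) n (a : R) (u : 'cV[R]_n) (M : 'M[R]_n) :
  a != 0 -> scales_vol M -> scales_vol (block_mx a%:M 0 u M : 'M[R]_(1 + n)).
Proof.
move=> a0 sM A b mA.
have [c [v bE]] : exists c v, b = row_mx c%:M v :> 'rV_(1 + n).
  exists (lsubmx (b : 'rV_(1 + n)) 0 0), (rsubmx (b : 'rV_(1 + n))).
  rewrite -[LHS](hsubmxK (b : 'rV_(1 + n))); congr row_mx.
  exact: mx11_scalar.
have mg := measurable_fun_first_section _ _ _ mA.
set g := (X in measurable_fun _ X) in mg.
pose phi t : n.-tuple (measurableTypeR R) :=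
  tuple_of_row (row_of_tuple t *m M + v).
have phiE t : row_of_tuple (phi t) = row_of_tuple t *m M + v.
  exact: tuple_of_rowK.
have affE (x : R) y : (row_mx x%:M y : 'rV_(1 + n)) *m block_mx a%:M 0 u M + b =
    row_mx (x * a + ((y *m u) 0 0 + c))%:M (y *m M + v) :> 'rV_(1 + n).
  rewrite bE mul_row_block add_row_mx mulmx0 add0r -scalar_mxM.
  by rewrite {1}[y *m u]mx11_scalar -!raddfD/= -addrA.
have gE t : lebesgue_measure [set x : R |
      A ((row_mx x%:M (row_of_tuple t) : 'rV_(1 + n))
         *m block_mx a%:M 0 u M + b)] =
    ((`|a|^-1)%:E * g (phi t))%E.
  pose d := (row_of_tuple t *m u) 0 0 + c.
  rewrite -(lebesgue_measure_affine _ a d)//; last first.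
    exact: measurable_first_section.
  by congr lebesgue_measure; apply/seteqP; split=> x /=; rewrite phiE affE.
rewrite (vol_cons_swap _ n); last exact: measurable_row_affine.
under eq_integral do rewrite /= gE.
have mphi : measurable_fun setT phi by exact: measurable_fun_affine.
rewrite ge0_integralZl//=; last first.
  exact: (measurableT_comp mg mphi).
rewrite (ge0_integral_scaling _ _ R (@lebesgue_tuple R n) phi `|\det M|^-1 g)//.
- rewrite (vol_cons_swap _ n)// muleA -EFinM (det_lblock a%:M) det_scalar expr1.
  by rewrite normrM invfM.
- move=> B mB.
  pose A' := [set y | B (tuple_of_row y)].
  have A'E : row_of_tuple @^-1` A' = B.
    by apply/seteqP; split=> t; rewrite /A'/= row_of_tupleK.
  by rewrite -A'E -[RHS](sM _ v) /measurable_row ?A'E.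
Qed.

Lemma scales_vol_upper (R : realType) n (U : 'M[R]_n) :
  (forall i j : 'I_n, (j < i)%N -> U i j = 0) -> \det U != 0 -> scales_vol U.
Proof.
elim: n U => [|n ih] U Uut dU.
  move=> A b mA; rewrite det_mx00 normr1 invr1 mul1e; congr vol.
  by apply/seteqP; split=> x /=; rewrite [_ *m _ + _]thinmx0 [x]thinmx0.
pose a := U 0 0; pose u := ursubmx (U : 'M[R]_(1 + n)).
pose U' := drsubmx (U : 'M[R]_(1 + n)).
have UE : U = block_mx a%:M u 0 U' :> 'M[R]_(1 + n).
  rewrite -[LHS](submxK (U : 'M[R]_(1 + n))); congr block_mx.
    rewrite [LHS]mx11_scalar !mxE; congr (_%:M).
    by congr (U _ _); apply: val_inj.
  by apply/matrixP=> i j; rewrite !mxE; apply: Uut; rewrite ord1.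
have : \det (block_mx a%:M u 0 U' : 'M[R]_(1 + n)) != 0 by rewrite -UE.
rewrite UE (det_ublock a%:M) mulf_eq0 negb_or det_scalar expr1
  => /andP[a0 dU'].
have sU' : scales_vol U'.
  by apply: ih => // i j ij; rewrite !mxE; apply: Uut.
apply: scales_vol_ublock => //.
Qed.

Lemma scales_vol_lower (R : realType) n (L : 'M[R]_n) :
  (forall i j : 'I_n, (i < j)%N -> L i j = 0) -> \det L != 0 -> scales_vol L.
Proof.
elim: n L => [|n ih] L Llt dL.
  move=> A b mA; rewrite det_mx00 normr1 invr1 mul1e; congr vol.
  by apply/seteqP; split=> x /=; rewrite [_ *m _ + _]thinmx0 [x]thinmx0.
pose a := L 0 0; pose u := dlsubmx (L : 'M[R]_(1 + n)).
pose L' := drsubmx (L : 'M[R]_(1 + n)).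
have LE : L = block_mx a%:M 0 u L' :> 'M[R]_(1 + n).
  rewrite -[LHS](submxK (L : 'M[R]_(1 + n))); congr block_mx.
    rewrite [LHS]mx11_scalar !mxE; congr (_%:M).
    by congr (L _ _); apply: val_inj.
  by apply/matrixP=> i j; rewrite !mxE; apply: Llt; rewrite ord1.
have : \det (block_mx a%:M 0 u L' : 'M[R]_(1 + n)) != 0 by rewrite -LE.
rewrite LE (det_lblock a%:M) mulf_eq0 negb_or det_scalar expr1
  => /andP[a0 dL'].
have sL' : scales_vol L'.
  by apply: ih => // i j ij; rewrite !mxE; apply: Llt.
apply: scales_vol_lblock => //.
Qed.

(** The LU decomposition of the transpose writes [M], up to a permutation of
its columns, as a lower times an upper triangular matrix. Transposing puts the
permutation on the right, where it acts on the image of [x |-> x M] and leaves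
its l1 norm unchanged. *)
Lemma scales_vol_mul_perm (R : realType) n (M : 'M[R]_n) :
  \det M != 0 -> exists s : {perm 'I_n}, scales_vol (M *m perm_mx s).
Proof.
case: n M => [|n] M dM.
  by exists 1%g; apply: scales_vol_upper => [[]//|]; rewrite det_mx00 oner_eq0.
have := cormen_lup_correct M^T; have := cormen_lup_perm M^T.
have := cormen_lup_lower M^T; have := cormen_lup_upper M^T.
have := cormen_lup_detL M^T.
case: cormen_lup => [[P L] U]/= dL Uut Llt /is_perm_mxP[s ->] PMLU.
exists s^-1%g.
have LUE : M *m perm_mx s^-1 = U^T *m L^T.
  by rewrite -trmx_mul -[L *m U]PMLU trmx_mul trmxK tr_perm_mx.
have dU : \det U != 0.
  apply: contraNneq dM => dU0; have := congr1 (fun M => \det M) PMLU.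
  rewrite -[_ * M^T]/(_ *m _) -[L * U]/(L *m U) !det_mulmx dU0 mulr0.
  rewrite det_perm det_tr => /eqP.
  by rewrite mulf_eq0 signr_eq0.
rewrite LUE; apply: scales_vol_mul.
- apply: scales_vol_lower => [i j ij|]; last by rewrite det_tr.
  by rewrite mxE Uut.
- apply: scales_vol_upper => [i j ij|]; last by rewrite det_tr dL oner_eq0.
  by rewrite mxE Llt ?(ltnW ij)//; case: eqP ij => // ->; rewrite ltnn.
Qed.

(** * The l1 norm and the volume of cross-polytopes *)

Definition norm1 (R : realType) n (x : 'rV[R]_n) : R := \sum_i `|x 0 i|.
Arguments norm1 {R n}.

Lemma norm1N (R : realType) n (x : 'rV[R]_n) : norm1 (- x) = norm1 x.
Proof. by apply: eq_bigr => i _; rewrite mxE normrN. Qed.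

Lemma ler_norm1D (R : realType) n (x y : 'rV[R]_n) :
  norm1 (x + y) <= norm1 x + norm1 y.
Proof.
rewrite /norm1 -big_split; apply: ler_sum => i _; rewrite mxE; exact: ler_normD.
Qed.

Lemma norm1Z (R : realType) n (c : R) (x : 'rV[R]_n) :
  norm1 (c *: x) = `|c| * norm1 x.
Proof.
by rewrite /norm1 mulr_sumr; apply: eq_bigr => i _; rewrite mxE normrM.
Qed.

Lemma norm1_perm (R : realType) n (x : 'rV[R]_n) (s : {perm 'I_n}) :
  norm1 (x *m perm_mx s) = norm1 x.
Proof.
rewrite /norm1 -[s in LHS]invgK -col_permE.
rewrite [RHS](reindex_inj (@perm_inj _ s^-1%g)).
by apply: eq_bigr => i _; rewrite mxE.
Qed.

Lemma norm1_int (R : realType) n (w : 'rV[int]_n) :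
  norm1 (map_mx intr w : 'rV[R]_n) = (\sum_i `|w 0%R i|)%N%:R.
Proof.
rewrite /norm1 natr_sum; apply: eq_bigr => i _.
by rewrite mxE -intr_norm -abszE.
Qed.

Definition cross_polytope (R : realType) n (r : R) : set 'rV[R]_n :=
  [set x | norm1 x <= r].
Arguments cross_polytope {R} n r.

Lemma measurable_cross_polytope (R : realType) n (r : R) :
  measurable_row (cross_polytope n r).
Proof.
have mf : measurable_fun setT (fun t : n.-tuple (measurableTypeR R) =>
    \sum_(i < n) `|tnth t i| : measurableTypeR R).
  apply: measurable_sum => i; apply: measurableT_comp => //.
  exact: measurable_tnth.
rewrite /measurable_row -[X in measurable X]setTI.
have -> : row_of_tuple @^-1` cross_polytope n r =
   (fun t : n.-tuple (measurableTypeR R) => \sum_(i < n) `|tnth t i|) @^-1`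
     `]-oo, r]%classic.
  have tE (t : n.-tuple R) : norm1 (row_of_tuple t) = \sum_(i < n) `|tnth t i|.
    by apply: eq_bigr => i _; rewrite mxE.
  by apply/seteqP; split=> t /=; rewrite in_itv/= /cross_polytope/= tE.
exact: mf.
Qed.

(** The l1 norm is invariant under permutations of the coordinates, so the
permutation produced by the LU decomposition disappears. *)
Lemma vol_cross_polytope_affine (R : realType) n (M : 'M[R]_n) b (r : R) :
  \det M != 0 ->
  vol [set x | cross_polytope n r (x *m M + b)] =
  ((`|\det M|^-1)%:E * vol (cross_polytope n r))%E.
Proof.
move=> dM; have [s sMs] := scales_vol_mul_perm _ _ _ dM.
have := sMs _ (b *m perm_mx s) (measurable_cross_polytope R n r).
rewrite det_mulmx det_perm normrM normr_sign mulr1 => <-.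
congr vol; apply/seteqP; split=> x /=;
by rewrite /cross_polytope/= mulmxA -mulmxDl norm1_perm.
Qed.

(** The section of a cross-polytope of radius [r] at height [x] has radius
[r - x]; this is the integral of the volumes of the sections over one half. *)
Lemma integral_cone (R : realType) n (r : R) : 0 <= r ->
  (\int[lebesgue_measure]_(x in `[0%R, r]) ((2 * (r - x)) ^+ n / n`!%:R)%:E =
    ((2 * r) ^+ n.+1 / n.+1`!%:R / 2)%:E)%E.
Proof.
rewrite le_eqVlt => /predU1P[<-|r0].
  by rewrite set_itv1 integral_set1 mulr0 expr0n !mul0r.
have n0 : (n`!%:R : R) != 0 by rewrite pnatr_eq0 -lt0n fact_gt0.
have n1 : (n.+1%:R : R) != 0 by rewrite pnatr_eq0.
pose p : {poly R} := - (2 ^+ n / n.+1`!%:R) *: (r%:P - 'X) ^+ n.+1.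
have dp x : (2 * (r - x)) ^+ n / n`!%:R = p^`().[x].
  rewrite /p derivZ deriv_exp derivB derivC derivX sub0r/=.
  rewrite !hornerE hornerMn !hornerE factS natrM exprMn -[_ *+ n.+1]mulr_natr.
  by field; apply/andP.
under eq_integral do rewrite dp.
rewrite integral_deriv_poly// -EFinB; congr EFin; rewrite /p !hornerE.
rewrite subrr expr0n/= mulr0 subr0 exprMn [2 ^+ n.+1]exprSr factS natrM.
by field; apply/andP.
Qed.

Lemma vol_cross_polytope (R : realType) n (r : R) : 0 <= r ->
  vol (cross_polytope n r) = ((2 * r) ^+ n / n`!%:R)%:E.
Proof.
elim: n r => [|n ih] r r0.
  rewrite volE /= diracE mem_set/=; first by rewrite expr0 fact0 divr1.
  by rewrite /cross_polytope/= /norm1 big_ord0.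
have norm1_cons (x : R) (y : 'rV[R]_n) :
    norm1 (row_mx x%:M y : 'rV_(1 + n)) = `|x| + norm1 y.
  rewrite /norm1 big_split_ord big_ord1 /= row_mxEl mxE eqxx mulr1n.
  by congr (_ + _); apply: eq_bigr => i _; rewrite row_mxEr.
have mf := measurable_fun_vol_section _ _ _
  (measurable_cross_polytope R n.+1 r).
rewrite (vol_cons _ n).
set f := (X in measurable_fun _ X) in mf.
(* Sections at [x] and [- x] agree, and they are empty beyond height [r]. *)
rewrite [LHS](ge0_even_integral _ f)//.
- rewrite (_ : (\int[_]_(_ in _) _)%E = (\int[lebesgue_measure]_(x in `[0%R, r])
      ((2 * (r - x)) ^+ n / n`!%:R)%:E)%E).
    by rewrite integral_cone// -EFinM; congr EFin; field.
  rewrite [LHS]integral_mkcond [RHS]integral_mkcond; apply: eq_integral => x _.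
  rewrite !patchE !mem_setE !in_itv/= andbT.
  have [x0|x0] /= := leP 0 x; last by [].
  have fE : f x = vol (cross_polytope n (r - x)).
    congr vol; apply/seteqP; split=> y /=;
    by rewrite /cross_polytope/= norm1_cons ger0_norm// lerBrDl.
  case: ifPn => [xr|]; first by rewrite fE ih// subr_ge0.
  rewrite -ltNge => rx.
  rewrite fE (_ : cross_polytope n (r - x) = set0) ?volE ?measure0//.
  apply/seteqP; split=> y //=; apply/negP; rewrite -ltNge.
  by rewrite (lt_le_trans (_ : _ < 0)) ?subr_lt0// sumr_ge0.
- move=> x; congr vol; apply/seteqP; split=> y /=;
  by rewrite /cross_polytope/= !norm1_cons normrN.
Qed.

(** * Counting integer vectors modulo a sublattice *)

(** The end point of a walk of [m] steps from the origin: [None] is a null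
step, and [Some (i, b)] a step along the [i]-th axis whose direction is given
by [b]. *)
Definition walk_end n m (f : {ffun 'I_m -> option ('I_n * bool)}) :
    'rV[int]_n :=
  \sum_j if f j is Some (i, b) then (-1) ^+ b *: delta_mx 0 i else 0.
Arguments walk_end {n m}.

(** A vector of l1 norm at most [m + 1] is null or comes one unit closer to the
origin when a nonzero entry is decreased in absolute value. Null steps are
there to reach the vectors of smaller norm. *)
Lemma walk_end_surj n m (w : 'rV[int]_n) :
  (\sum_i `|w 0%R i| <= m)%N ->
  exists f : {ffun 'I_m -> option ('I_n * bool)}, w = walk_end f.
Proof.
elim: m w => [|m ih] w.
  rewrite leqn0 sum_nat_eq0 => /forallP w0; exists [ffun=> None].
  rewrite /walk_end big_ord0; apply/rowP => i; rewrite mxE; apply/eqP.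
  by rewrite -absz_eq0 (implyP (w0 i)).
have [->|w0 wm] := eqVneq w 0.
  move=> _; exists [ffun=> None]; rewrite /walk_end big1// => i _.
  by rewrite ffunE.
have [i wi] : exists i, w 0 i != 0.
  apply/existsP; apply: contraNT w0 => /existsPn w0; apply/eqP/rowP => i.
  by rewrite mxE; apply/eqP; have := w0 i; rewrite negbK.
pose b := w 0 i < 0.
pose e : 'rV[int]_n := (-1) ^+ b *: delta_mx 0 i.
have [|f wE] := ih (w - e).
  rewrite (bigD1 i)//= in wm; rewrite (bigD1 i)//=.
  rewrite (eq_bigr (fun j => `|w 0%R j|%N)); last first.
    by move=> j ji; rewrite !mxE eqxx (negPf ji) mulr0 subr0.
  rewrite -ltnS (leq_trans _ wm)// -addSn leq_add2r.
  rewrite !mxE !eqxx mulr1 /b.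
  by case: (ltrgt0P (w 0 i)) wi => //= wi _; rewrite ?expr0 ?expr1; lia.
exists [ffun j => oapp f (Some (i, b)) (unlift ord0 j)].
rewrite /walk_end big_ord_recl ffunE unlift_none/= -/e.
under eq_bigr do rewrite ffunE liftK/=.
by rewrite -[\sum_(_ < _) _]/(walk_end f) -wE addrC subrK.
Qed.

Lemma card_walk n m :
  #|{ffun 'I_m -> option ('I_n * bool)}| = ((2 * n).+1 ^ m)%N.
Proof.
by rewrite card_ffun card_option card_prod card_bool !card_ord mulnC.
Qed.

(** In the Smith normal form [M = L D Q], the reduction of [x Q^-1] modulo the
diagonal entries of [D] identifies the class of [x] modulo [Z^n M]; the matrix
[L] only changes the basis of the sublattice. *)
Lemma lattice_classes n (M : 'M[int]_n) : \det M != 0 ->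
  exists (T : finType) (cl : 'rV[int]_n -> T),
    #|T| = `|\det M|%N /\
    forall x y, cl x = cl y -> exists w : 'rV[int]_n, x - y = w *m M.
Proof.
move=> dM; have [L uL [Q uQ [d _ ME]]] := int_Smith_normal_form M.
set D := (X in _ *m X *m _) in ME.
have DE : D = diag_mx (\row_i d`_i).
  by apply/matrixP=> i j; rewrite !mxE -val_eqE.
have dME : `|\det M|%N = (\prod_(i < n) `|(d`_i)%R|)%N.
  rewrite ME !det_mulmx !abszM.
  have unit1 (P : 'M[int]_n) : P \in unitmx -> `|\det P|%N = 1%N.
    by rewrite unitmxE => /orP[] /eqP->.
  rewrite (unit1 L)// (unit1 Q)// mul1n muln1 DE det_diag.
  rewrite (big_morph absz abszM (erefl _)).
  by apply: eq_bigr => i _; rewrite mxE.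
have d0 (i : 'I_n) : (0 < `|(d`_i)%R|)%N.
  rewrite lt0n; apply: contraNneq dM => di0.
  by rewrite -absz_eq0 dME (bigD1 i)//= di0.
pose T := fprod (fun i : 'I_n => 'I_(`|(d`_i)%R|.-1.+1)).
pose c (x : 'rV[int]_n) i : int := (((x *m invmx Q)%R 0%R i %% (d`_i)%R)%Z).
exists T, (fun x => [fprod i : 'I_n => inord `|c x i|%N]); split.
  by rewrite card_fprod dME; apply: eq_bigr => i _; rewrite card_ord prednK.
move=> x y cxy.
have cE i : c x i = c y i.
  have := congr1 (fun f : T => val (f i)) cxy; rewrite !fprodE /=.
  have di0 : d`_i != 0 by rewrite -absz_gt0.
  have cP z : (`|c z i| < `|(d`_i)%R|.-1.+1)%N.
    rewrite prednK// -ltz_nat gez0_abs ?modz_ge0// abszE.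
    exact: ltz_mod.
  rewrite !inordK// => /(congr1 Posz); rewrite !gez0_abs ?modz_ge0//.
pose X := (x - y) *m invmx Q.
pose q := \row_i (X 0%R i %/ (d`_i)%R)%Z.
have XE : X = q *m D.
  apply/rowP => i.
  rewrite DE mul_mx_diag [RHS]mxE [q _ _]mxE [(\row__ _) _ _]mxE divzK//.
  have := cE i; rewrite /c => /eqP; rewrite eqz_mod_dvd => dvd_i.
  by rewrite /X mulmxBl mxE [X in _ + X]mxE.
exists (q *m invmx L).
by rewrite ME !mulmxA mulmxKV// -XE mulmxKV.
Qed.

(** A vector of [F] is determined by its class modulo [Z^n M] and by its
difference with a fixed representative in [F] of that class, which a walk of
[m] steps encodes. *)
Lemma count_lattice_translates n m (M : 'M[int]_n) (F : seq 'rV[int]_n) :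
  \det M != 0 -> uniq F ->
  (forall x y w, x \in F -> y \in F -> x - y = w *m M ->
     (\sum_i `|w 0%R i| <= m)%N) ->
  (size F <= `|\det M| * (2 * n).+1 ^ m)%N.
Proof.
move=> dM uF Fw; have [T [cl [cT clP]]] := lattice_classes n M dM.
pose x0 c := nth 0 F (find (fun x => cl x == c) F).
have x0P x : x \in F -> x0 (cl x) \in F /\ cl (x0 (cl x)) = cl x.
  move=> xF; have hF : has (fun y => cl y == cl x) F by apply/hasP; exists x.
  by split; [rewrite mem_nth// -has_find|exact/eqP/(nth_find 0 hF)].
have /boolp.choice[code codeE] : forall x,
    exists f : {ffun 'I_m -> option ('I_n * bool)},
    x \in F -> x - x0 (cl x) = walk_end f *m M.
  move=> x; have [xF|xF] := boolP (x \in F); last by exists [ffun=> None].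
  have [x0F clx0] := x0P x xF.
  have [w wE] := clP _ _ (esym clx0).
  have [f fE] := walk_end_surj n m w (Fw _ _ _ xF x0F wE).
  by exists f; rewrite -fE.
pose g x := (cl x, code x).
have gI : {in F &, injective g}.
  move=> x y xF yF [clE cE]; apply: (addIr (- x0 (cl x))).
  by rewrite codeE// clE codeE// cE.
rewrite -cT -card_walk -card_prod cardE -(size_map g).
by apply: uniq_leq_size => [|z _]; rewrite ?mem_enum// map_inj_in_uniq.
Qed.

(** * Convexity and affine dimension *)

Lemma convex_set_segment (R : realType) n (K : set 'rV[R]_n) x y (l : R) :
  convex_set K -> K x -> K y -> 0 <= l <= 1 -> K (l *: x + (1 - l) *: y).
Proof.
move=> cK Kx Ky l01.
have [l0 l1] := andP l01.
pose l' : {i01 R} := Itv01 l0 l1.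
by have := cK x y l' (mem_set Kx) (mem_set Ky); rewrite inE.
Qed.

(** The sum of [|c i|] stays in factor so that the induction does not have to
renormalise the coefficients; symmetry absorbs their signs. *)
Lemma symmetric_convex_sum (R : realType) n (K : set 'rV[R]_n) (I : Type)
    (r : seq I) (c : I -> R) (v : I -> 'rV[R]_n) :
  convex_set K -> centrally_symmetric K -> K 0 -> (forall i, K (v i)) ->
  exists2 x, K x & \sum_(i <- r) c i *: v i = (\sum_(i <- r) `|c i|) *: x.
Proof.
move=> cK sK K0 Kv; elim: r => [|i r [x Kx xE]].
  by exists 0 => //; rewrite !big_nil scaler0.
rewrite !big_cons xE; set S := \sum_(i <- r) _.
have S0 : 0 <= S by apply: sumr_ge0.
have [y Ky ->] : exists2 y, K y & c i *: v i = `|c i| *: y.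
  have [_|_] := ger0P (c i); first by exists (v i).
  exists (- v i); last by rewrite scaleNr scalerN opprK.
  by rewrite sK; exists (v i).
have [TS0|TSneq0] := eqVneq (`|c i| + S) 0.
  exists 0 => //; rewrite TS0 !scale0r.
  have [/eqP-> /eqP->] : `|c i| == 0 /\ S == 0.
    by apply/andP; rewrite -paddr_eq0// TS0.
  by rewrite !scale0r addr0.
(* Barycentre of [y] and [x] with weights proportional to [|c i|] and [S]. *)
exists ((`|c i| / (`|c i| + S)) *: y + (1 - `|c i| / (`|c i| + S)) *: x).
  apply: convex_set_segment => //.
  rewrite divr_ge0 ?addr_ge0//= ler_pdivrMr ?mul1r ?lerDl//.
  by rewrite lt0r TSneq0 addr_ge0.
rewrite scalerDr !scalerA; congr (_ *: _ + _ *: _).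
  by rewrite mulrCA divff ?mulr1.
by rewrite mulrBr mulrCA divff// !mulr1 addrC addKr.
Qed.

Lemma cross_polytope_sub (R : realType) n (K : set 'rV[R]_n) (A : 'M[R]_n) y :
  convex_set K -> centrally_symmetric K -> K 0 -> (forall i, K (row i A)) ->
  norm1 y <= 1 -> K (y *m A).
Proof.
move=> cK sK K0 KA y1; rewrite mulmx_sum_row.
have [x Kx ->] := symmetric_convex_sum _ _ _ _ (index_enum 'I_n) (y 0)
  (fun i => row i A) cK sK K0 KA.
rewrite -/(norm1 y) -[_ *: x]addr0 -(scaler0 _ (1 - norm1 y)).
by apply: convex_set_segment => //; rewrite y1 andbT sumr_ge0.
Qed.

(** The affine hull is the whole space, so a free family of elements of [X] of
maximal size spans it, and its members are the rows of [A]. *)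
Lemma affine_dim_full_rows (R : realType) n (X : set 'rV[R]_n) :
  affine_dim X n ->
  exists A : 'M[R]_n, (forall i, X (row i A)) /\ \det A != 0.
Proof.
move=> [p [U [XE dU]]].
have dimR : dim 'rV[R]_n = n by exact: mul1n.
have UT : U = fullv.
  by apply/eqP; rewrite eqEdim subvf/= dimvf dU dimR.
have hullT y : affine_hull X y.
  by rewrite XE; exists (y - p); [rewrite UT /= memvf|rewrite addrC subrK].
pose P k := `[< exists s : seq 'rV[R]_n,
  [/\ size s = k, forall x, x \in s -> X x & free s] >].
have P0 : exists k, P k.
  by exists 0; apply/asboolP; exists [::]; split; rewrite ?nil_free.
have Pn k : P k -> (k <= n)%N.
  move=> /asboolP[s [<- _ fs]]; have := dimvS (subvf (span s)).
  by rewrite dimvf dimR (eqP fs).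
case: (ex_maxnP P0 Pn) => k /asboolP[s [sk sX fs]] kmax.
have Xs x : X x -> x \in span s.
  move=> Xx; apply: contraT => xs; suff: (k.+1 <= k)%N by rewrite ltnn.
  apply: kmax; apply/asboolP; exists (x :: s); split => [|y|].
  - by rewrite /= sk.
  - by rewrite inE => /predU1P[->|/sX].
  - by rewrite free_cons xs.
have sT : span s = fullv.
  apply/eqP; rewrite eqEsubv subvf/=; apply/subvP => y _.
  have [m [c [a [Xa _ ->]]]] := hullT y.
  by apply: rpred_sum => i _; rewrite rpredZ// Xs.
have kn : k = n.
  by have := dimvf ('rV[R]_n); rewrite -sT (eqP fs) sk dimR.
have st : size s == n by rewrite sk kn.
exists (\matrix_i s`_i); split=> [i|].
  by rewrite rowK; apply/sX/mem_nth; rewrite (eqP st).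
apply/negP => /det0P[v v0]; rewrite mulmx_sum_row.
under eq_bigr do rewrite rowK.
move=> /(@freeP _ _ _ (Tuple st) fs) vE; case/negP: v0; apply/eqP/rowP => i.
by rewrite vE mxE.
Qed.

(** * Packing cross-polytopes into a symmetric convex set *)

(** On the integer lattice the floor is the inverse of the embedding of integer
vectors, as [floor_rowK] says. *)
Definition floor_row (R : realType) n (x : 'rV[R]_n) : 'rV[int]_n :=
  map_mx Num.floor x.
Arguments floor_row {R n}.

Lemma floor_rowK (R : realType) n (x : 'rV[R]_n) :
  integer_lattice R n x -> map_mx intr (floor_row x) = x.
Proof. by move=> xZ; apply/rowP => i; rewrite !mxE floorK. Qed.

(** With [B = A^-1] this is the set [(x + t C) / (t + 1)], where [C] is the
image by [A] of the unit cross-polytope, as [lattice_pieceE] makes visible. The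
definition has the form of the preimage of a cross-polytope by an affine map. *)
Definition lattice_piece (R : realType) n (t : nat) (B : 'M[R]_n)
    (x : 'rV[R]_n) : set 'rV[R]_n :=
  [set p | cross_polytope n t%:R (p *m (t.+1%:R *: B) - x *m B)].

Lemma lattice_pieceE (R : realType) n t (B : 'M[R]_n) x p :
  lattice_piece R n t B x p = (norm1 ((t.+1%:R *: p - x) *m B) <= t%:R).
Proof.
by rewrite /lattice_piece/cross_polytope/= -scalemxAr mulmxBl -scalemxAl.
Qed.

(** A point of the piece is the convex combination with weights [1 / (t + 1)]
and [t / (t + 1)] of [x] and of a point of [C], and both lie in [K]. *)
Lemma lattice_piece_sub (R : realType) n t (A : 'M[R]_n) x (K : set 'rV[R]_n) :
  (0 < t)%N -> \det A != 0 ->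
  convex_set K -> centrally_symmetric K -> (forall i, K (row i A)) -> K x ->
  lattice_piece R n t (invmx A) x `<=` K.
Proof.
move=> t0 dA cK sK KA Kx p; rewrite lattice_pieceE => pt.
have uA : A \in unitmx by rewrite unitmxE unitfE.
have K0 : K 0.
  have Kx' : K (- x) by rewrite sK; exists x.
  have : K (2^-1 *: x + (1 - 2^-1) *: - x).
    by apply: convex_set_segment => //; lra.
  rewrite scalerN -scalerBl (_ : 2^-1 - (1 - 2^-1) = 0); last lra.
  by rewrite scale0r.
set w := (_ - x) *m _ in pt.
have Kw : K (t%:R^-1 *: w *m A).
  apply: cross_polytope_sub => //; rewrite norm1Z ger0_norm ?invr_ge0//.
  by rewrite ler_pdivrMl ?ltr0n// mulr1.
have -> : p = t.+1%:R^-1 *: x + (1 - t.+1%:R^-1) *: (t%:R^-1 *: w *m A).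
  rewrite -scalemxAl mulmxKV// scalerA.
  have -> : (1 - t.+1%:R^-1) * t%:R^-1 = t.+1%:R^-1 :> R.
    by rewrite -natr1; field; rewrite natr1 !pnatr_eq0/= -lt0n.
  by rewrite scalerBr scalerA mulVf ?pnatr_eq0// scale1r addrC subrK.
apply: convex_set_segment => //.
by rewrite invr_ge0 ler0n invf_le1 ?ltr0n// ler1n.
Qed.

Lemma measurable_lattice_piece (R : realType) n t (B : 'M[R]_n) x :
  measurable_row (lattice_piece R n t B x).
Proof.
exact: (measurable_row_affine _ _ _ _ _ _ (measurable_cross_polytope R n t%:R)).
Qed.

Lemma vol_lattice_piece (R : realType) n t (A : 'M[R]_n) x : \det A != 0 ->
  vol (lattice_piece R n t (invmx A) x) =
    (`|\det A| * ((2 * t%:R / t.+1%:R) ^+ n / n`!%:R))%:E.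
Proof.
move=> dA; rewrite vol_cross_polytope_affine; last first.
  rewrite detZ det_inv mulf_neq0 ?expf_neq0 ?pnatr_eq0//.
  by rewrite invr_eq0.
rewrite vol_cross_polytope// -EFinM detZ det_inv; congr EFin.
rewrite normrM normfV normrX normr_nat invfM invrK.
rewrite [in RHS]expr_div_n; field.
by rewrite !pnatr_eq0 -lt0n fact_gt0 expf_neq0 ?pnatr_eq0.
Qed.

(** If [p] is in the pieces of [x] and [y], then [(x - y) A^-1] is a difference
of two vectors of l1 norm at most [t]. *)
Lemma lattice_piece_multiplicity (R : realType) n t (M : 'M[int]_n)
    (F : seq 'rV[R]_n) p :
  \det M != 0 -> uniq F -> (forall x, x \in F -> integer_lattice R n x) ->
  (count (fun x => p \in lattice_piece R n t (invmx (map_mx intr M)) x) F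
    <= `|\det M| * (2 * n).+1 ^ (t + t))%N.
Proof.
move=> dM uF FZ; set A : 'M[R]_n := map_mx intr M.
have uA : A \in unitmx by rewrite unitmxE det_map_mx unitfE intr_eq0.
rewrite -size_filter; set Fp := [seq x <- F | _].
have FpZ x : x \in Fp -> map_mx intr (floor_row x) = x.
  by rewrite mem_filter => /andP[_ /FZ]; exact: floor_rowK.
rewrite -(size_map floor_row); apply: count_lattice_translates => //.
  rewrite map_inj_in_uniq ?filter_uniq// => x y xF yF xy.
  by rewrite -(FpZ x)// xy FpZ.
move=> _ _ w /mapP[x xF ->] /mapP[y yF ->] xyw.
have xyE : x - y = map_mx intr w *m A.
  by rewrite -(FpZ x)// -(FpZ y)// -map_mxB xyw map_mxM.
have wE : map_mx intr w =
    (t.+1%:R *: p - y) *m invmx A - (t.+1%:R *: p - x) *m invmx A.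
  by rewrite -mulmxBl opprB addrC addrA subrK xyE mulmxK.
rewrite -(ler_nat R) -norm1_int wE natrD.
have pc z : z \in Fp -> norm1 ((t.+1%:R *: p - z) *m invmx A) <= t%:R.
  by rewrite mem_filter => /andP[/set_mem]; rewrite lattice_pieceE.
apply: le_trans (ler_norm1D _ _ _ _) _.
by rewrite norm1N lerD// pc.
Qed.

(** The pieces lie in [K]; the sum of their volumes and their multiplicity both
contain the factor [|det A|]. *)
Lemma lattice_count_le_vol (R : realType) n (t : nat) (K : set 'rV[R]_n) :
  (0 < t)%N -> convex_set K -> centrally_symmetric K ->
  affine_dim (K `&` integer_lattice R n) n ->
  (((lattice_count K)%:R * ((2 * t%:R / t.+1%:R) ^+ n / n`!%:R))%:E <=
    ((2 * n).+1 ^ (t + t))%:R%:E * vol K)%E.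
Proof.
move=> t0 cK sK /affine_dim_full_rows[A [KA dA]].
pose M : 'M[int]_n := map_mx Num.floor A.
have AE : A = map_mx intr M.
  apply/matrixP => i j; rewrite !mxE floorK//.
  by have [_ /(_ j)] := KA i; rewrite mxE.
have dM : \det M != 0 by move: dA; rewrite AE det_map_mx intr_eq0.
have dMA : `|\det A| = `|\det M|%N%:R.
  by rewrite AE det_map_mx -intr_norm -abszE.
rewrite /lattice_count; set F : seq 'rV[R]_n := fset_set _.
have FK x : x \in F -> (K `&` integer_lattice R n) x.
  (* [fset_set] of an infinite set is empty. *)
  rewrite /F; have [fS|iS] := pselect (finite_set (K `&` integer_lattice R n)).
    by rewrite in_fset_set// => /set_mem.
  by rewrite /fset_set; case: pselect.
pose piece (x : 'rV[R]_n) := lattice_piece R n t (invmx A) x.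
pose P x : set (n.-tuple (measurableTypeR R)) := row_of_tuple @^-1` piece x.
have mP x : measurable (P x) by exact: measurable_lattice_piece.
have PN q :
    (count (fun x => q \in P x) F <= `|\det M| * (2 * n).+1 ^ (t + t))%N.
  have FZ x : x \in F -> integer_lattice R n x by move=> /FK[].
  have := lattice_piece_multiplicity R n t M F (row_of_tuple q) dM
    (fset_uniq _) FZ.
  rewrite -AE; apply: leq_trans; apply: sub_count => x /set_mem Pxq.
  exact: mem_set.
have volP : (\sum_(x <- F) lebesgue_tuple (P x))%E = (`|\det A| *
    ((lattice_count K)%:R * ((2 * t%:R / t.+1%:R) ^+ n / n`!%:R)))%:E.
  rewrite (eq_bigr _ (fun x _ => vol_lattice_piece _ _ t A x dA)) sumEFin.
  rewrite big_const_seq count_predT iter_addr_0 -[size F]/(lattice_count K).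
  rewrite -[_ *+ _]mulr_natl mulrCA; reflexivity.
have := sum_measure_le_multiplicity _ _ R (@lebesgue_tuple R n) _ F P _ mP PN.
rewrite volP natrM -dMA; set g := _%:R * (_ / _).
rewrite !EFinM -!muleA lee_pmul2l//; last by rewrite lte_fin normr_gt0.
move=> /le_trans; apply; rewrite lee_pmul2l// -bigcup_seq.
apply: (le_vol _ _ (\bigcup_(x in [set` F]) piece x)) => p [x /FK[Kx _]].
by apply: lattice_piece_sub => // i; have [] := KA i.
Qed.

(** * Exponential against polynomial growth *)

(** The constant is crude: any bound linear in [e] is enough to find a root of
high order of a number larger than 1. *)
Lemma exprD1_le_linear (R : realType) (k : nat) (e : R) :
  0 <= e <= 1 -> (1 + e) ^+ k <= 1 + 3 ^+ k * e.
Proof.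
move=> /andP[e0 e1]; elim: k => [|k ih]; first by rewrite !expr0; lra.
rewrite exprSr; apply: (@le_trans _ _ ((1 + 3 ^+ k * e) * (1 + e))).
  by rewrite ler_wpM2r// addr_ge0.
have k1 : 1 <= 3 ^+ k :> R by rewrite exprn_ege1// ler1n.
have h1 : 0 <= (3 ^+ k - 1) * e by rewrite mulr_ge0// subr_ge0.
have h2 : 0 <= 3 ^+ k * (e * (1 - e)) by rewrite !mulr_ge0 ?subr_ge0 ?exprn_ge0.
rewrite exprSr; lra.
Qed.

Lemma bernoulli_ge (R : realType) (e : R) n :
  0 <= e -> 1 + n%:R * e <= (1 + e) ^+ n.
Proof.
move=> e0; elim: n => [|n ih]; first by rewrite mul0r addr0 expr0.
rewrite exprSr; apply: le_trans (_ : (1 + n%:R * e) * (1 + e) <= _).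
  rewrite -natr1; have : 0 <= n%:R * (e * e) by rewrite !mulr_ge0. nra.
by rewrite ler_wpM2r// addr_ge0.
Qed.

(** Write [q >= (1 + e)^(2 m)]; then [q^n] is at least
[((1 + n e)^2)^m], by Bernoulli, and [(1 + n e)^2 >= 2 n + 1] as soon as
[n e^2 >= 2]. *)
Lemma pow_dominates_polynomial (R : realType) (q : R) m : 1 < q ->
  exists n0 : nat, forall n, (n0 <= n)%N -> ((2 * n).+1 ^ m)%:R <= q ^+ n.
Proof.
move=> q1; pose e := Num.min 1 ((q - 1) / 3 ^+ (2 * m)).
have e0 : 0 < e by rewrite lt_min ltr01 divr_gt0 ?subr_gt0// exprn_gt0.
have e1 : e <= 1 by rewrite ge_min lexx.
have eq : (1 + e) ^+ (2 * m) <= q.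
  apply: le_trans (exprD1_le_linear _ _ _ _) _; first by rewrite ltW.
  rewrite -lerBrDl -ler_pdivlMl ?exprn_gt0// mulrC.
  by rewrite ge_min lexx orbT.
exists (Num.truncn (2 / (e * e))).+1 => n n0n.
have ne : 2 <= n%:R * (e * e).
  rewrite -ler_pdivrMr ?mulr_gt0//; apply/ltW/(lt_le_trans (truncnS_gt _)).
  by rewrite ler_nat.
apply: (@le_trans _ _ (((1 + e) ^+ (2 * m)) ^+ n)); last first.
  by rewrite lerXn2r// nnegrE ?exprn_ge0// ?addr_ge0// ltW// (lt_trans ltr01).
rewrite -exprM [X in _ ^+ X]mulnC mulnA exprM natrX.
rewrite lerXn2r ?nnegrE// ?exprn_ge0 ?addr_ge0 ?(ltW e0)//.
rewrite exprM; apply: (@le_trans _ _ ((1 + n%:R * e) ^+ 2)).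
  rewrite -natr1 natrM; have : 0 <= n%:R :> R by []. nra.
rewrite lerXn2r ?nnegrE// ?exprn_ge0 ?addr_ge0 ?mulr_ge0 ?(ltW e0)//.
by rewrite bernoulli_ge ?(ltW e0).
Qed.

(** * The standard cross-polytope as an extremal body *)

Lemma norm1_continuous (R : realType) n : continuous (@norm1 R n).
Proof.
apply: continuous_big => [|i _ x]; first exact: add_continuous.
apply: (@continuous_comp _ _ _ (fun y : 'rV[R]_n => y 0 i) (@Num.norm _ R)).
  exact: coord_continuous.
exact: norm_continuous.
Qed.

Lemma cross_polytope_convex_body (R : realType) n (r : R) : 0 < r ->
  convex_body (cross_polytope n r).
Proof.
move=> r0; split.
- apply: bounded_closed_compact; last first.
    apply: (preimage_closed _ (@closed_le _ r)) => x _.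
    exact: norm1_continuous.
  exists r; split=> [|M rM x xr]; first exact: num_real.
  rewrite /globally/=; apply/ltW/(le_lt_trans _ rM)/(le_trans _ xr).
  have -> : `|x| = mx_norm x by [].
  have [->|/mx_norm_neq0[i ->]] := eqVneq (mx_norm x) 0; first exact: sumr_ge0.
  rewrite /norm1 (bigD1 i.2)//= ord1 lerDl; exact: sumr_ge0.
- move=> x y l; rewrite !inE /cross_polytope/= => xr yr.
  apply: le_trans (ler_norm1D _ _ _ _) _; rewrite !norm1Z.
  have l0 : 0 <= l%:num by [].
  have l1 : 0 <= 1 - l%:num by rewrite subr_ge0.
  rewrite !ger0_norm// -[leRHS]mul1r -[X in X * r](subrKC l%:num) [leRHS]mulrDl.
  by rewrite lerD// ler_wpM2l.
- exists 0; apply: (norm1_continuous R n 0 [set y | y <= r]).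
  rewrite [norm1 0]big1; last by move=> i _; rewrite mxE normr0.
  exact: lt_le_nbhsl.
Qed.

Lemma cross_polytope_symmetric (R : realType) n (r : R) :
  centrally_symmetric (cross_polytope n r).
Proof.
apply/seteqP; split=> [x xr|_ [x xr <-]]; last first.
  by rewrite /cross_polytope/= norm1N.
by exists (- x); [rewrite /cross_polytope/= norm1N|rewrite opprK].
Qed.

Lemma norm1_delta (R : realType) n (i : 'I_n) :
  norm1 (delta_mx 0 i : 'rV[R]_n) = 1.
Proof.
rewrite /norm1 (bigD1 i)//= big1 => [|j ji]; rewrite !mxE !eqxx/=.
  by rewrite normr1 addr0.
by rewrite (negPf ji) normr0.
Qed.

Lemma cross_polytope0 (R : realType) n :
  (cross_polytope n 1 `&` integer_lattice R n) 0.
Proof.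
split=> [|i]; last by rewrite mxE.
by rewrite /cross_polytope/= /norm1 big1// => i _; rewrite mxE normr0.
Qed.

Lemma cross_polytope_delta (R : realType) n (i : 'I_n) :
  (cross_polytope n 1 `&` integer_lattice R n) (delta_mx 0 i).
Proof.
by split=> [|j]; [rewrite /cross_polytope/= norm1_delta|rewrite mxE natr_int].
Qed.

Lemma cross_polytope_affine_dim (R : realType) n :
  affine_dim (cross_polytope n 1 `&` integer_lattice R n) n.
Proof.
exists 0, fullv; split; last by rewrite dimvf; exact: mul1n.
apply/seteqP; split=> y _ //; first by exists y; rewrite ?add0r//= memvf.
(* [y] is the combination of the basis vectors with its own entries as
   coefficients, completed at the origin to make the coefficients sum to 1. *)
exists n.+1, (fun k => oapp (y 0) (1 - \sum_i y 0 i) (unlift ord0 k)),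
  (fun k => oapp (fun i => delta_mx 0 i) 0 (unlift ord0 k)); split.
- move=> k; case: unliftP => [i _|_]; first exact: cross_polytope_delta.
  exact: cross_polytope0.
- rewrite big_ord_recl unlift_none/= [X in _ + X](eq_bigr (y 0)) ?subrK//.
  by move=> i _; rewrite liftK.
- rewrite big_ord_recl unlift_none/= scaler0 add0r.
  under eq_bigr do rewrite liftK/=.
  exact: row_sum_delta.
Qed.

(** The integer vectors of l1 norm at most 1 are the ends of the walks of
length 1. *)
Lemma finite_cross_polytope_lattice (R : realType) n :
  finite_set (cross_polytope n 1 `&` integer_lattice R n).
Proof.
pose g (f : {ffun 'I_1 -> option ('I_n * bool)}) : 'rV[R]_n :=
  map_mx intr (walk_end f).
apply: (@sub_finite_set _ _ (range g)); last exact/finite_image/finite_finset.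
move=> x [x1 xZ]; have := x1; rewrite /cross_polytope/=.
rewrite -{1}(floor_rowK _ _ x xZ) norm1_int (ler_nat R _ 1).
by move=> /walk_end_surj[f fE]; exists f => //; rewrite /g -fE floor_rowK.
Qed.

Lemma lattice_count_cross_polytope (R : realType) n :
  (2 <= lattice_count (cross_polytope n.+1 1 : set 'rV[R]_n.+1))%N.
Proof.
pose e : 'rV[R]_n.+1 := delta_mx 0 ord0.
have e0 : 0 != e.
  apply/eqP => /rowP/(_ ord0)/eqP; rewrite !mxE !eqxx eq_sym oner_eq0//.
rewrite -[2%N]/(size [:: 0; e]); apply: uniq_leq_size => [|x].
  by rewrite /= inE e0.
rewrite in_fset_set ?mem_setE; last exact: finite_cross_polytope_lattice.
rewrite !inE => /orP[]/eqP->; first exact: cross_polytope0.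
exact: cross_polytope_delta.
Qed.

(** * The asymptotic inequality and its optimality *)

Theorem theorem1p1 (R : realType) :
  (forall eps : R, 0 < eps <= 1 ->
    exists n_eps : nat, forall n : nat, (n_eps <= n)%N ->
    forall K : set 'rV[R]_n,
      convex_body K -> centrally_symmetric K ->
      affine_dim (K `&` integer_lattice R n) n ->
      (((2 - eps) ^+ n / n`!%:R * (lattice_count K)%:R)%:E <= vol K)%E)
  /\
  (forall c : R, 2 < c ->
    ~ (forall eps : R, 0 < eps <= 1 ->
        exists n_eps : nat, forall n : nat, (n_eps <= n)%N ->
        forall K : set 'rV[R]_n,
          convex_body K -> centrally_symmetric K ->
          affine_dim (K `&` integer_lattice R n) n ->
          (((c - eps) ^+ n / n`!%:R * (lattice_count K)%:R)%:E <= vol K)%E)).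
Proof.
split=> [eps /andP[eps0 eps1]|c c2 H].
  have [t t0 tP] : exists2 t : nat,
      (0 < t)%N & 2 - eps < 2 * t%:R / t.+1%:R :> R.
    (* [2 t / (t + 1) = 2 - 2 / (t + 1)], and [t > 2 / eps] suffices. *)
    exists (Num.truncn (2 / eps)).+1 => //.
    have := truncnS_gt (2 / eps); set t : R := _%:R => s1.
    rewrite -natr1 -/t ltr_pdivlMr; last by rewrite addr_gt0.
    rewrite ltr_pdivrMr// in s1; nra.
  have e2 : 0 < 2 - eps by lra.
  have [|n0 n0P] := pow_dominates_polynomial R
      ((2 * t%:R / t.+1%:R) / (2 - eps)) (t + t).
    by rewrite ltr_pdivlMr ?mul1r.
  exists n0 => n n0n K [_ cK _] sK dK.
  have := lattice_count_le_vol R n t K t0 cK sK dK.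
  have N0 : (0 : R) < ((2 * n).+1 ^ (t + t))%:R by rewrite ltr0n expn_gt0.
  move=> main; rewrite -(@lee_pmul2l _ ((2 * n).+1 ^ (t + t))%:R%:E)//.
  apply: le_trans main; rewrite -EFinM lee_fin [leLHS]mulrA [leLHS]mulrC.
  apply: ler_wpM2l => //; rewrite mulrA.
  apply: ler_wpM2r; first by rewrite invr_ge0.
  by have := n0P n n0n; rewrite expr_div_n ler_pdivlMr ?exprn_gt0.
(* This choice gives [c - eps >= 2]. *)
pose eps := Num.min 1 (c - 2).
have [|m mP] := H eps; first by rewrite lt_min ltr01 subr_gt0 c2/= ge_min lexx.
have ceps : 2 <= c - eps.
  by rewrite lerBrDr addrC -lerBrDr ge_min lexx orbT.
have := mP _ (leqnSn m) (cross_polytope m.+1 1)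
  (cross_polytope_convex_body _ _ _ ltr01) (cross_polytope_symmetric _ _ _)
  (cross_polytope_affine_dim _ _).
rewrite vol_cross_polytope// lee_fin mulr1 mulrAC.
rewrite ler_pM2r ?invr_gt0 ?ltr0n ?fact_gt0// leNgt => /negP; apply.
have p2 : (2 : R) ^+ m.+1 <= (c - eps) ^+ m.+1.
  by rewrite lerXn2r// nnegrE; lra.
apply: (lt_le_trans (y := (2 : R) ^+ m.+1 * 2)).
  by rewrite ltr_pMr ?exprn_gt0// ltr1n.
rewrite ler_pM// ?exprn_ge0// ler_nat.
exact: lattice_count_cross_polytope.
Qed.
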